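(* Let $G$ be a finite, simple, connected graph of order $n=n(G)\geq 3$ with ${\rm diam}(G)=2$ which is not self-centered. If (i) $n'(G)\geq 3$, or (ii) $n'(G)=2$ and ${\rm avd}(G')>0$, or (iii) $n'(G)=1$ and ${\rm avd}(G')>1+\frac{1}{2(n-1)}$, then $E_1(G)<E_2(G)$. Otherwise, $E_1(G)>E_2(G)$.
   Context: For a connected graph $G$ and $v\in V(G)$, $\varepsilon_G(v)=\max_{u} d_G(v,u)$ is the eccentricity; ${\rm diam}(G)=\max_v\varepsilon_G(v)$, ${\rm rad}(G)=\min_v\varepsilon_G(v)$; $G$ is self-centered if ${\rm diam}(G)={\rm rad}(G)$. $E_1(G)=\sum_{v}\varepsilon_G(v)^2$, $E_2(G)=\sum_{uv\in E(G)}\varepsilon_G(u)\varepsilon_G(v)$. A vertex is universal if its degree is $n(G)-1$; $n'(G)$ is the number of universal vertices of $G$, and $G'$ is the subgraph of $G$ induced by the non-universal vertices. For a graph $X$, ${\rm avd}(X)=2m(X)/n(X)$ is its average degree, where $m(X)$ is the number of edges and $n(X)$ the number of vertices. *)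

(* Defs.v *)
From HB Require Import structures.
From mathcomp Require Import all_boot all_order all_algebra.

Set Implicit Arguments.
Unset Strict Implicit.
Unset Printing Implicit Defensive.

Import Order.TTheory GRing.Theory Num.Theory.

Record sgraph := SGraph {
  vertex :> finType;
  adj : rel vertex;
  adj_sym : symmetric adj;
  adj_irr : irreflexive adj }.

Definition order_graph (G : sgraph) : nat := #|G|.

Definition edges (G : sgraph) : {set {set G}} :=
  [set [set p.1; p.2] | p in [set p : G * G | adj p.1 p.2]].

Definition size_graph (G : sgraph) : nat := #|edges G|.

Definition degree (G : sgraph) (v : G) : nat := #|[set u : G | adj v u]|.

Definition connected_graph (G : sgraph) : Prop :=
  forall u v : G, connect (@adj G) u v.

(* There is a walk with k edges from u to v. *)
Definition walk (G : sgraph) (k : nat) (u v : G) : bool :=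
  [exists p : k.-tuple G, path (@adj G) u p && (last u p == v)].

(* The least length of a walk from u to v. If there is one, there is one of
   length less than #|G|; otherwise the value is #|G|. *)
Definition dist (G : sgraph) (u v : G) : nat :=
  find (fun k => walk k u v) (iota 0 #|G|).

Definition ecc (G : sgraph) (v : G) : nat := \max_(u : G) dist v u.

Definition diam (G : sgraph) : nat := \max_(v : G) ecc v.

(* The starting value diam G bounds every eccentricity, so for a nonempty graph
   this is the minimum of the eccentricities. *)
Definition rad (G : sgraph) : nat := \big[minn/diam G]_(v : G) ecc v.

Definition self_centered (G : sgraph) : Prop := diam G = rad G.

Definition E1 (G : sgraph) : nat := \sum_(v : G) ecc v ^ 2.

(* An edge A = [set u; v] has u != v, so its factor is ecc u * ecc v. *)
Definition E2 (G : sgraph) : nat :=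
  \sum_(A in edges G) \prod_(v in A) ecc v.

Definition universal (G : sgraph) (v : G) : bool := degree v == #|G| - 1.

Definition nb_universal (G : sgraph) : nat := #|[set v : G | universal v]|.

Section Induced.
Variables (G : sgraph) (A : {set G}).

Definition induced_adj : rel {v : G | v \in A} :=
  fun u v => adj (val u) (val v).

Fact induced_adj_sym : symmetric induced_adj.
Proof. by move=> u v; apply: adj_sym. Qed.

Fact induced_adj_irr : irreflexive induced_adj.
Proof. by move=> u; apply: adj_irr. Qed.

Definition induced : sgraph := SGraph induced_adj_sym induced_adj_irr.
End Induced.

Definition nonuniversal_subgraph (G : sgraph) : sgraph :=
  induced [set v : G | ~~ universal v].

Definition avd (G : sgraph) : rat :=
  ((2 * size_graph G)%N%:R / (order_graph G)%:R)%R.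

(* Main.v *)
(** Since [diam G = 2], universal vertices have eccentricity 1 and all other
    vertices have eccentricity 2. Let [k] be the number of universal vertices,
    [r] that of the others, and [m'] the number of edges of [G'].
    Then [E1 G = k + 4 r] and [2 * E2 G = k (k - 1) + 4 k r + 8 m'], where
    [k, r > 0]. The sign of [E2 G - E1 G] is that of [4 m' - 2 r - 1] if
    [k = 1], that of [4 m' - 1] if [k = 2], and positive if [k >= 3]; in the
    first two cases equality is impossible by parity. *)

Require Import Defs.
From HB Require Import structures.
From mathcomp Require Import all_boot all_order all_algebra.
From mathcomp Require Import zify ring.

Set Implicit Arguments.
Unset Strict Implicit.
Unset Printing Implicit Defensive.

Import Order.TTheory GRing.Theory Num.Theory.

(** * Distances, universal vertices and eccentricities *)

Section Distance.
Variable G : sgraph.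

Lemma walk0 (u v : G) : walk 0 u v = (u == v).
Proof.
apply/existsP/eqP => [[p]|->]; last by exists [tuple]; rewrite /= eqxx.
by rewrite (tuple0 p) /= => /eqP.
Qed.

Lemma walk1 (u v : G) : walk 1 u v = adj u v.
Proof.
apply/existsP/idP => [[p]|auv]; last first.
  by exists [tuple v]; rewrite /= auv eqxx.
by case: p => [[|x []]] //= _; rewrite andbT => /andP[h /eqP <-].
Qed.

Lemma dist_leq (k : nat) (u v : G) : k < #|G| -> walk k u v -> dist u v <= k.
Proof.
move=> ltk w; rewrite leqNgt; apply/negP => /(before_find 0).
by rewrite nth_iota // add0n w.
Qed.

(** The strict bound means that the search in [dist] succeeded, since [#|G|] is its value on
    failure. *)
Lemma walk_dist (u v : G) : dist u v < #|G| -> walk (dist u v) u v.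
Proof.
move=> lt; have := lt; rewrite {1}/dist -{2}(size_iota 0 #|G|) -has_find.
by move=> /(nth_find 0); rewrite nth_iota // add0n.
Qed.

Lemma dist_gt1 (u v : G) :
  1 < #|G| -> u != v -> ~~ adj u v -> 1 < dist u v.
Proof.
move=> n1 nuv nadj; rewrite ltnNge; apply/negP => le1.
have := walk_dist (leq_ltn_trans le1 n1).
case: (dist u v) le1 => [|[|//]] _; first by rewrite walk0 (negbTE nuv).
by rewrite walk1 (negbTE nadj).
Qed.

(** The neighbours of [v] lie in the complement of [v], so having [#|G| - 1] of them makes the two
    sets equal. *)
Lemma universalP (v : G) :
  reflect (forall u, u != v -> adj v u) (universal v).
Proof.
have sub : [set u | adj v u] \subset [set~ v].
  by apply/subsetP => u; rewrite !inE; apply: contraTneq => ->; rewrite adj_irr.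
have -> : universal v = ([set u | adj v u] == [set~ v]).
  by rewrite -(subset_leqif_cards sub).2 cardsC1 -subn1.
apply: (iffP eqP) => [e u nuv|h].
  by have := in_setC1 u v; rewrite -e inE nuv.
apply/eqP; rewrite eqEsubset sub; apply/subsetP => u.
by rewrite !inE; apply: h.
Qed.

Lemma universal_adj (u v : G) : universal u -> adj u v = (v != u).
Proof.
move=> /universalP h; apply/idP/idP; last exact: h.
by apply: contraTneq => ->; rewrite adj_irr.
Qed.

Lemma ecc_universal (v : G) : 1 < #|G| -> universal v -> ecc v = 1.
Proof.
move=> n1 /universalP uv; apply/eqP; rewrite eqn_leq; apply/andP; split.
  apply/bigmax_leqP => u _; case: (eqVneq u v) => [->|nuv].
    by rewrite (leq_trans (@dist_leq 0 _ _ (ltnW n1) _)) // walk0.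
  by apply: dist_leq; rewrite // walk1 uv.
have [u nuv] : exists u, u != v.
  have /card_gt0P[u] : 0 < #|[set~ v]| by rewrite cardsC1 ltn_predRL.
  by rewrite !inE; exists u.
apply: leq_trans (leq_bigmax u); rewrite lt0n; apply/eqP => d0.
have := @walk_dist v u; rewrite d0 walk0 => /(_ (ltnW n1)).
by rewrite eq_sym (negbTE nuv).
Qed.

Lemma ecc_nonuniversal (v : G) :
  1 < #|G| -> diam G = 2 -> ~~ universal v -> ecc v = 2.
Proof.
move=> n1 d2 nuv; apply/eqP; rewrite eqn_leq; apply/andP; split.
  by rewrite -d2; apply: leq_bigmax.
(* A non-neighbour other than [v] is at distance at least 2; without one, [v] would be universal. *)
have [/existsP[u /andP[neq nadj]]|/existsPn h] :=
  boolP [exists u, (v != u) && ~~ adj v u].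
  exact: leq_trans (dist_gt1 n1 neq nadj) (leq_bigmax u).
case/negP: nuv; apply/universalP => u nuv.
by have := h u; rewrite eq_sym nuv /= negbK.
Qed.

End Distance.

(** * Double counting of edges *)

Lemma sum_edges (G : sgraph) (F : {set G} -> nat) :
  \sum_u \sum_(v | adj u v) F [set u; v] = 2 * \sum_(A in edges G) F A.
Proof.
rewrite pair_big_dep /=.
(* Ordered adjacent pairs are grouped by the edge that they span. *)
rewrite (partition_big (fun p : G * G => [set p.1; p.2]) (mem (edges G))) /=;
  last by move=> p hp; apply/imsetP; exists p; rewrite ?inE.
rewrite big_distrr /=; apply: eq_bigr => A /imsetP[[a b]]; rewrite inE /= => ab ->{A}.
have neq : a != b by apply: contraTneq ab => ->; rewrite adj_irr.
rewrite (eq_bigr (fun=> F [set a; b])) => [|p /andP[_ /eqP->//]].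
rewrite sum_nat_const; congr (_ * _).
(* The fibre over [[set a; b]] consists of the two orientations of this edge. *)
rewrite -[RHS](_ : #|[set (a, b); (b, a)]| = 2); last first.
  by rewrite cards2 xpair_eqE (negbTE neq).
apply: eq_card => -[x y]; rewrite !inE unfold_in /= !xpair_eqE.
apply/andP/orP => [[xy /eqP e]|[] /andP[/eqP-> /eqP->]]; last 2 first.
- by rewrite ab eqxx.
- by rewrite adj_sym ab setUC eqxx.
have nxy : x != y by apply: contraTneq xy => ->; rewrite adj_irr.
have := set21 x y; have := set22 x y; rewrite e !inE.
case/orP=> /eqP ey; case/orP=> /eqP ex; subst x y; rewrite ?eqxx in nxy *;
  by [left|right|].
Qed.

Lemma handshake (G : sgraph) : \sum_(u : G) degree u = 2 * size_graph G.
Proof.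
rewrite /size_graph -sum1_card -(sum_edges (fun=> 1)).
by apply: eq_bigr => u _; rewrite sum1dep_card.
Qed.

(** Transfers the edge count from the subtype to sums over [G], with adjacency read as 0 or 1. *)
Lemma size_induced (G : sgraph) (A : {set G}) :
  2 * size_graph (induced A) = \sum_(u in A) \sum_(v in A) adj u v.
Proof.
rewrite -handshake [RHS]big_sub; apply: eq_bigr => u _.
rewrite [RHS]big_sub /degree -sum1dep_card [LHS]big_mkcond /=.
by apply: eq_bigr => v _; rewrite /induced_adj; case: adj.
Qed.

Lemma order_induced (G : sgraph) (A : {set G}) : order_graph (induced A) = #|A|.
Proof. exact: card_sig. Qed.

Lemma nb_universal_compl (G : sgraph) :
  nb_universal G + order_graph (nonuniversal_subgraph G) = order_graph G.
Proof.
rewrite order_induced /nb_universal /order_graph.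
rewrite -(cardsC [set v : G | universal v]); congr (_ + #|pred_of_set _|).
by apply/setP => v; rewrite !inE.
Qed.

(** * Both indices in terms of [k], [r] and [m'] *)

Section DiameterTwo.
Variable G : sgraph.
Hypotheses (n1 : 1 < #|G|) (d2 : diam G = 2).
Let k := nb_universal G.
Let r := order_graph (nonuniversal_subgraph G).
Let m' := size_graph (nonuniversal_subgraph G).

(** A general [f] serves both the squares in [E1] and, as the identity, the sums over neighbours. *)
Lemma sum_ecc (f : nat -> nat) : \sum_(v : G) f (ecc v) = k * f 1 + r * f 2.
Proof.
rewrite (bigID (@universal G)) /= /k /r order_induced /nb_universal.
congr (_ + _).
  rewrite (eq_bigr (fun=> f 1)) => [|v uv]; last by rewrite ecc_universal.
  by rewrite sum_nat_const cardsE.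
rewrite (eq_bigr (fun=> f 2)) => [|v uv]; last by rewrite ecc_nonuniversal.
by rewrite sum_nat_const cardsE.
Qed.

Lemma E1_diam2 : E1 G = k + 4 * r.
Proof. by rewrite /E1 (sum_ecc (fun x => x ^ 2)); lia. Qed.

(** Only [u] itself is missing from the neighbours of [u]; the successor restores its eccentricity
    1. *)
Lemma sum_ecc_adj_universal (u : G) :
  universal u -> (\sum_(v | adj u v) ecc v).+1 = k + 2 * r.
Proof.
move=> uu; have := sum_ecc id; rewrite (bigD1 u) //= ecc_universal //.
by rewrite (eq_bigl _ _ (fun v => universal_adj v uu)); lia.
Qed.

(** Every universal vertex is a neighbour of [u] and contributes 1; each remaining neighbour
    contributes 2. *)
Lemma sum_ecc_adj_nonuniversal (u : G) : ~~ universal u ->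
  \sum_(v | adj u v) ecc v
    = k + 2 * \sum_(v in [set v : G | ~~ universal v]) adj u v.
Proof.
move=> nu; rewrite big_mkcond (bigID (@universal G)) /=; congr (_ + _).
  rewrite /k /nb_universal -sum1dep_card; apply: eq_bigr => v uv.
  rewrite adj_sym universal_adj // ecc_universal //.
  by case: eqP nu => // ->; rewrite uv.
rewrite big_distrr /=; apply: eq_big => [v|v nv]; first by rewrite inE.
by rewrite ecc_nonuniversal //; case: (adj u v).
Qed.

(** Each edge is counted from both ends. Universal vertices contribute [k * (k + 2 * r - 1)] in
    total, and the [+ k] on the left avoids this subtraction. Any other vertex contributes [2 * k]
    plus four times its degree in [G']. *)
Lemma double_E2_diam2 : 2 * E2 G + k = k * (k + 2 * r) + 2 * (r * k) + 8 * m'.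
Proof.
rewrite /E2 -sum_edges.
rewrite (eq_bigr (fun u => ecc u * \sum_(v | adj u v) ecc v)); last first.
  move=> u _; rewrite big_distrr /=; apply: eq_bigr => v uv.
  rewrite big_setU1 ?big_set1 // inE.
  by apply: contraTneq uv => ->; rewrite adj_irr.
rewrite (bigID (@universal G)) /= addnAC -[RHS]addnA; congr (_ + _).
  rewrite (eq_bigr (fun=> (k + 2 * r).-1)) => [|u uu].
    rewrite sum_nat_const -cardsE -/(nb_universal G) -/k.
    by case: (k) => // k'; rewrite -mulnSr prednK.
  by rewrite ecc_universal // mul1n -(sum_ecc_adj_universal uu).
set N := [set v : G | ~~ universal v].
rewrite (eq_bigr (fun u => 2 * k + 4 * \sum_(v in N) adj u v)) => [|u nu].
  rewrite big_split /= sum_nat_const -cardsE -big_distrr /=.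
  have <- : 2 * m' = \sum_(u | ~~ universal u) \sum_(v in N) adj u v.
    by rewrite /m' size_induced; apply: eq_bigl => u; rewrite inE.
  by rewrite -order_induced -/r; lia.
by rewrite ecc_nonuniversal // sum_ecc_adj_nonuniversal // mulnDr mulnA.
Qed.

(** If all vertices were universal, no eccentricity would exceed 1. *)
Lemma nonuniversal_order_gt0 : 0 < r.
Proof.
rewrite lt0n; apply/eqP => r0.
have: 2 <= 1; last by [].
rewrite -{1}d2; apply/bigmax_leqP => v _.
case: (boolP (universal v)) => [/ecc_universal->//|nv].
move: r0; rewrite /r order_induced => /eqP; rewrite cards_eq0 => /eqP/setP/(_ v).
by rewrite !inE nv.
Qed.

(** Without universal vertices all eccentricities are 2, and so is their minimum, as its starting
    value is [diam G = 2]. *)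
Lemma nb_universal_gt0 : ~ self_centered G -> 0 < k.
Proof.
move=> nsc; rewrite lt0n; apply/eqP => k0; apply: nsc.
rewrite /self_centered /rad d2.
apply: (big_rec (fun x => 2 = x)) => [//|v x _ <-].
rewrite ecc_nonuniversal ?minnn //; apply/negP => uv.
by move/eqP: k0; rewrite cards_eq0 => /eqP/setP/(_ v); rewrite !inE uv.
Qed.

End DiameterTwo.

(** * Comparison of the indices by the number of universal vertices *)

Theorem theorem2p3 (G : sgraph)
    (hconn : connected_graph G)
    (hn : 3 <= order_graph G)
    (hdiam : diam G = 2)
    (hnsc : ~ self_centered G) :
  let G' := nonuniversal_subgraph G in
  let cond :=
    3 <= nb_universal G
    \/ (nb_universal G = 2 /\ (0 < avd G')%R)
    \/ (nb_universal G = 1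
        /\ (1 + 1 / (2 * ((order_graph G)%:R - 1)) < avd G')%R) in
  (cond -> E1 G < E2 G) /\ (~ cond -> E1 G > E2 G).
Proof.
have n1 : 1 < #|G| by apply: ltnW.
have := nb_universal_compl G; have := E1_diam2 n1 hdiam.
have := double_E2_diam2 n1 hdiam; have := nonuniversal_order_gt0 n1 hdiam.
have := nb_universal_gt0 n1 hdiam hnsc.
rewrite /= /avd.
move: (nb_universal G) (order_graph _) (size_graph _) (order_graph G) (E1 G) (E2 G).
move=> k r m n e1 e2 k0 r0 e2E -> <-.
have rR : (0 < r%:R :> rat)%R by rewrite ltr0n.
have c2 : (0 < (2 * m)%:R / r%:R :> rat)%R = (0 < m).
  by rewrite pmulr_lgt0 ?invr_gt0 // ltr0n muln_gt0.
(* For a single universal vertex the order is [1 + r], so clearing denominators leaves an inequality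
   in [nat]. *)
have c1 : (1 + 1 / (2 * ((1 + r)%:R - 1)) < (2 * m)%:R / r%:R :> rat)%R
          = (2 * r + 1 < 4 * m).
  rewrite ltr_pdivlMr // natrD [X in (X - 1)%R]addrC addrK.
  have -> : ((1 + 1 / (2 * r%:R)) * r%:R = (2 * r + 1)%:R / 2 :> rat)%R.
    by rewrite natrD natrM; field; rewrite lt0r_neq0.
  by rewrite ltr_pdivrMr // -natrM ltr_nat; congr (_ < _); lia.
rewrite c2; case: k k0 e2E => [//|[|[|k]]] _ e2E.
- by rewrite c1; split; lia.
- by split; lia.
(* With [K = k + 3] universal vertices, [2 * (E2 - E1) = K * (K - 3) + 4 * r * (K - 2) + 8 * m],
   which is positive because [r > 0]. *)
- by split; nia.
Qed.
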